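(* Let $p\ge 1$ and let $U^p(\Gamma)$ be an $H^1$-conforming polynomial basis on the reference triangle $\Gamma$, split into vertex, edge and cell base functions $\mathcal V^p_i$, $\mathcal E^p_j$, $\mathcal C^p_{123}$. Consider the template $\mathcal T=\{\mathcal T_1,\mathcal T_2,\mathcal T_3,\mathcal T_{12},\mathcal T_{13},\mathcal T_{23},\mathcal T_{123}\}$ with $$\mathcal T_1=\{\mathbf e_1,-\mathbf e_2\},\quad \mathcal T_2=\{\mathbf e_1-\mathbf e_2,-\mathbf e_2\},\quad \mathcal T_3=\{\mathbf e_1-\mathbf e_2,-\mathbf e_1\},$$ $$\mathcal T_{12}=\{\mathbf e_1,\mathbf e_2\},\quad \mathcal T_{13}=\{-\mathbf e_2,\mathbf e_1\},\quad \mathcal T_{23}=\{-\tfrac12(\mathbf e_1+\mathbf e_2),\mathbf e_2-\mathbf e_1\},\quad \mathcal T_{123}=\{\mathbf e_1,\mathbf e_2\}.$$ Then the tensor product of the template with the basis, $$\Big\{\bigoplus_{i=1}^3\mathcal V^p_i\otimes\mathcal T_i\Big\}\oplus\Big\{\bigoplus_{j\in\mathcal J}\mathcal E^p_j\otimes\mathcal T_j\Big\}\oplus\{\mathcal C^p_{123}\otimes\mathcal T_{123}\},\qquad \mathcal J=\{(1,2),(1,3),(2,3)\},$$ yields a unisolvent Brezzi-Douglas-Marini element $\mathcal{BDM}^p(\Gamma)$.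
   Context: $\Gamma=\{(\xi,\eta)\in[0,1]^2 \mid \xi+\eta\le 1\}$ has vertices $v_1=(0,0)$, $v_2=(0,1)$, $v_3=(1,0)$, edges $e_{12},e_{13},e_{23}$ ($e_{ij}$ joins $v_i$ and $v_j$) and cell $c_{123}$ (its interior). $\mathbf e_1,\mathbf e_2$ is the Cartesian basis of $\mathbb R^2$. $P^p(\Gamma)$ denotes the polynomials of total degree at most $p$. $H^1$-conforming polynomial basis $U^p(\Gamma)$: linearly independent (unisolvent) polynomials in $P^p(\Gamma)$ with $\dim U^p(\Gamma)=\dim P^p(\Gamma)=(p+2)(p+1)/2$, each associated with one polytope: one vertex base function for each vertex ($\mathcal V^p_i$, dimension $1$), $p-1$ edge base functions for each edge ($\mathcal E^p_j$), and $(p-2)(p-1)/2$ cell base functions ($\mathcal C^p_{123}$). A vertex base function vanishes at all other vertices and on the non-neighbouring edge; an edge base function vanishes on all other edges; a cell base function vanishes on the whole boundary. For a set of scalar base functions $\mathcal S$ and a set of vectors $\mathcal T_\ast$, $\mathcal S\otimes\mathcal T_\ast$ denotes all products $n\,\boldsymbol\ell$ with $n\in\mathcal S$, $\boldsymbol\ell\in\mathcal T_\ast$. ''Unisolvent Brezzi-Douglas-Marini element'' means: the vectorial base functions so obtained are linearly independent and form a basis of the Brezzi-Douglas-Marini space, whose polynomial space on $\Gamma$ is $[P^p(\Gamma)]^2$. *)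

(* Defs.v *)
From HB Require Import structures.
From mathcomp Require Import all_boot all_order all_algebra.
From mathcomp Require Import reals.
From mathcomp Require Import zify.
From mathcomp.multinomials Require Import mpoly.

Set Implicit Arguments.
Unset Strict Implicit.
Unset Printing Implicit Defensive.

Import Order.TTheory GRing.Theory Num.Theory.
Local Open Scope ring_scope.

Section LinearAlgebra.

(* The polynomial rings below are infinite-dimensional over R, so vector.v's
   [free] and [basis_of], which need a vectType, do not apply to them. *)
Variables (R : nzRingType) (V : lmodType R).

Definition lincomb (s : seq V) (c : 'I_(size s) -> R) : V :=
  \sum_(i < size s) c i *: s`_i.

Definition lin_indep (s : seq V) : Prop :=
  forall c : 'I_(size s) -> R, lincomb c = 0 -> forall i, c i = 0.

Definition is_basis (W : V -> Prop) (s : seq V) : Prop :=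
  lin_indep s /\
  (forall v, W v <-> exists c : 'I_(size s) -> R, v = lincomb c).

End LinearAlgebra.

Inductive vertex := V1 | V2 | V3.
Inductive edge := E12 | E13 | E23.
Inductive polytope := Vert of vertex | Edge of edge | C123.

Definition vertices : seq vertex := [:: V1; V2; V3].
Definition edges : seq edge := [:: E12; E13; E23].
Definition polytopes : seq polytope :=
  map Vert vertices ++ map Edge edges ++ [:: C123].

Definition endpoints (j : edge) : vertex * vertex :=
  match j with E12 => (V1, V2) | E13 => (V1, V3) | E23 => (V2, V3) end.

Definition neighbours (i : vertex) (j : edge) : Prop :=
  i = (endpoints j).1 \/ i = (endpoints j).2.

(* The sum over all polytopes is dim P^p = (p+2)(p+1)/2,
   see [sum_num_base_functions]. *)
Definition num_base_functions (p : nat) (t : polytope) : nat :=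
  match t with
  | Vert _ => 1
  | Edge _ => p - 1
  | C123 => ((p - 2) * (p - 1)) %/ 2
  end.

Lemma sum_num_base_functions (p : nat) : (1 <= p)%N ->
  sumn (map (num_base_functions p) polytopes) = (((p + 2) * (p + 1)) %/ 2)%N.
Proof.
move=> p_gt0; rewrite /polytopes /=.
have -> : ((p + 2) * (p + 1) = (p - 2) * (p - 1) + 3 * p * 2)%N by nia.
by rewrite divnDMl //; lia.
Qed.

Section Triangle.

Variable R : realType.

Definition e1 : 'rV[R]_2 := delta_mx 0 0.
Definition e2 : 'rV[R]_2 := delta_mx 0 1.

Definition vertex_point (i : vertex) : 'rV[R]_2 :=
  match i with V1 => 0 | V2 => e2 | V3 => e1 end.

Definition on_edge (j : edge) (x : 'rV[R]_2) : Prop :=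
  exists2 t : R, 0 <= t <= 1 &
    x = (1 - t) *: vertex_point (endpoints j).1
        + t *: vertex_point (endpoints j).2.

(* Gamma has nonempty interior, so a polynomial function on Gamma is
   identified with its formal polynomial in the two Cartesian coordinates. *)
Definition eval_at (n : {mpoly R[2]}) (x : 'rV[R]_2) : R := n.@[x 0].

Definition vanishes_at (n : {mpoly R[2]}) (i : vertex) : Prop :=
  eval_at n (vertex_point i) = 0.

Definition vanishes_on (n : {mpoly R[2]}) (j : edge) : Prop :=
  forall x, on_edge j x -> eval_at n x = 0.

(* [msize] is one plus the total degree. *)
Definition Pp (p : nat) : {pred {mpoly R[2]}} :=
  [pred n : {mpoly R[2]} | (msize n <= p.+1)%N].

Record h1_conforming_basis (p : nat) (B : polytope -> seq {mpoly R[2]})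
    : Prop := H1ConformingBasis {
  h1_degree : forall t, {subset B t <= Pp p};
  h1_indep : lin_indep (flatten (map B polytopes));
  h1_size : forall t, size (B t) = num_base_functions p t;
  h1_vertex_vertex : forall i i' n,
    n \in B (Vert i) -> i' <> i -> vanishes_at n i';
  h1_vertex_edge : forall i j n,
    n \in B (Vert i) -> ~ neighbours i j -> vanishes_on n j;
  h1_edge : forall j j' n,
    n \in B (Edge j) -> j' <> j -> vanishes_on n j';
  h1_cell : forall j n, n \in B C123 -> vanishes_on n j
}.

Definition vpoly := {ffun 'I_2 -> {mpoly R[2]}}.

Definition vprod (n : {mpoly R[2]}) (l : 'rV[R]_2) : vpoly :=
  [ffun k => l 0 k *: n].

Definition tensor (S : seq {mpoly R[2]}) (T : seq 'rV[R]_2) : seq vpoly :=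
  [seq vprod n l | n <- S, l <- T].

Definition template_tensor (T : polytope -> seq 'rV[R]_2)
    (B : polytope -> seq {mpoly R[2]}) : seq vpoly :=
  flatten [seq tensor (B t) (T t) | t <- polytopes].

Definition bdm_template (t : polytope) : seq 'rV[R]_2 :=
  match t with
  | Vert V1 => [:: e1; - e2]
  | Vert V2 => [:: e1 - e2; - e2]
  | Vert V3 => [:: e1 - e2; - e1]
  | Edge E12 => [:: e1; e2]
  | Edge E13 => [:: - e2; e1]
  | Edge E23 => [:: - (2^-1 *: (e1 + e2)); e2 - e1]
  | C123 => [:: e1; e2]
  end.

Definition bdm_space (p : nat) (u : vpoly) : Prop := forall k, u k \in Pp p.

Definition unisolvent_bdm (p : nat) (s : seq vpoly) : Prop :=
  is_basis (bdm_space p) s.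

End Triangle.

(* Main.v *)
Require Import Defs.
From mathcomp Require Import all_boot all_order all_algebra.
From mathcomp Require Import reals.
From mathcomp.multinomials Require Import mpoly.
From mathcomp Require Import zify ring lra.

(* Each set of the template is a basis of R^2. Hence n (x) T, with n ranging
   over a basis of P^p, is a basis of P^p (x) R^2 = [P^p]^2: reading off the two
   Cartesian components reduces everything to one 2x2 linear system per scalar
   base function. That U^p is a basis of P^p follows from its independence by
   counting monomials. *)

Set Implicit Arguments.
Unset Strict Implicit.
Unset Printing Implicit Defensive.

Import GRing.Theory Num.Theory.
Local Open Scope ring_scope.

Section NatIndexedCombinations.

Variables (R : nzRingType) (V : lmodType R).
Implicit Types (s : seq V) (W : V -> Prop).

(** The type ['I_(size s)] changes whenever [s] is rewritten. Coefficients indexed by [nat] survive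
    such rewriting and can be read at shifted or doubled indices. *)
Let natfun m (c : 'I_m -> R) (i : nat) : R := oapp c 0 (insub i).

Let natfunE m (c : 'I_m -> R) (i : 'I_m) : natfun c i = c i.
Proof. by rewrite /natfun valK. Qed.

Lemma lincomb_nat s (c : 'I_(size s) -> R) :
  exists2 c' : nat -> R, (forall i : 'I_(size s), c' i = c i) &
    lincomb c = \sum_(i < size s) c' i *: s`_i.
Proof.
exists (natfun c) => [i|]; first exact: natfunE.
by apply: eq_bigr => i _; rewrite natfunE.
Qed.

Lemma lin_indepP s :
  lin_indep s <-> forall c : nat -> R, \sum_(i < size s) c i *: s`_i = 0 ->
    forall i, (i < size s)%N -> c i = 0.
Proof.
split=> [s_indep c c0 i ltis | s_indep c c0 i].
  exact: (s_indep (fun j => c j) c0 (Ordinal ltis)).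
have [c' c'E lcE] := lincomb_nat c.
by rewrite -c'E; apply: s_indep => //; rewrite -lcE.
Qed.

Lemma is_basisP W s :
  is_basis W s <-> lin_indep s /\
    (forall v, W v <->
       exists c : nat -> R, v = \sum_(i < size s) c i *: s`_i).
Proof.
split=> -[s_indep spanE]; split=> // v; rewrite spanE; split=> -[c ->].
- by have [c' _ ->] := lincomb_nat c; exists c'.
- by exists (fun i => c i).
- by exists (fun i => c i).
- by have [c' _ ->] := lincomb_nat c; exists c'.
Qed.

Lemma size_flatten_pairs (T : Type) (f g : T -> V) (r : seq T) :
  size (flatten [seq [:: f x; g x] | x <- r]) = (size r).*2.
Proof. by elim: r => //= x r ->. Qed.

(** Entry [i] of [r] contributes the positions [2i] and [2i+1] of the flattened list. *)
Lemma sum_flatten_pairs (T : Type) (x0 : T) (f g : T -> V) (r : seq T)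
    (c : nat -> R) (s := flatten [seq [:: f x; g x] | x <- r]) :
  \sum_(i < size s) c i *: s`_i =
  \sum_(i < size r)
    (c i.*2 *: f (nth x0 r i) + c i.*2.+1 *: g (nth x0 r i)).
Proof.
rewrite {}/s; elim: r c => [|x r IHr] c /=; first by rewrite !big_ord0.
rewrite !big_ord_recl /= addrA; congr (_ + _).
exact: (IHr (fun i => c i.+2)).
Qed.

End NatIndexedCombinations.

(** Monomials of degree [k] in [n+1] variables are multisets of [k] variables, listed by [mons k].
    For an upper bound it is enough that these lists cover all monomials of degree below [d]. *)
Lemma leq_card_bmultinom n d :
  (#|{: 'X_{1..n.+1 < d}}| <= \sum_(k < d) 'C(k + n, k))%N.
Proof.
pose mons k := [seq s2m t | t : k.-tuple 'I_n.+1 <- enum (basis n.+1 k)].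
pose ms := flatten [seq mons k | k : 'I_d].
have <- : size ms = (\sum_(k < d) 'C(k + n, k))%N.
  rewrite size_flatten /shape -map_comp sumnE big_map big_enum /=.
  by apply: eq_bigr => k _; apply: size_basis.
rewrite cardE -(size_map val); apply: uniq_leq_size.
  by rewrite map_inj_uniq ?enum_uniq //; apply: val_inj.
move=> _ /mapP[m _ ->]; apply/flattenP.
exists (mons (mdeg m)); last by rewrite -basis_cover.
by apply/mapP; exists (Ordinal (bmdeg m)); rewrite ?mem_enum.
Qed.

(** Independence makes the coefficient matrix [A] of [s] row free. It has at least as many rows as
    columns, so it is also row full, and every coefficient vector is a combination of its rows. *)
Lemma lin_indep_mpoly_basis (K : fieldType) n d (s : seq {mpoly K[n]}) :
  lin_indep s -> {in s, forall q, (msize q <= d)%N} ->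
  (#|{: 'X_{1..n < d}}| <= size s)%N ->
  is_basis (fun q => (msize q <= d)%N) s.
Proof.
move=> s_indep s_deg le_card; split=> // v.
have nth_deg (i : 'I_(size s)) : (msize s`_i <= d)%N.
  by apply: s_deg; apply: mem_nth.
have lc_deg (c : 'I_(size s) -> K) : (msize (lincomb c) <= d)%N.
  apply: (leq_trans (msize_sum _ _ _)); apply/bigmax_leqP_seq => i _ _.
  exact: leq_trans (msizeZ_le _ _) (nth_deg i).
split=> [v_deg | [c ->]]; last exact: lc_deg.
pose coef (q : {mpoly K[n]}) : 'rV[K]_#|{: 'X_{1..n < d}}| :=
  \row_j q@_(enum_val j : 'X_{1..n < d}).
(* The row [coef q] records only the monomials of degree below [d]; under the size bound all other
   coefficients are zero. *)
have coef_inj p q : (msize p <= d)%N -> (msize q <= d)%N ->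
    coef p = coef q -> p = q.
  move=> p_deg q_deg epq; apply/mpolyP => m.
  have [lt_md | le_dm] := ltnP (mdeg m) d; last first.
    by rewrite !memN_msupp_eq0 // msize_mdeg_ge // (leq_trans _ le_dm).
  have /rowP/(_ (enum_rank (BMultinom lt_md))) := epq.
  by rewrite !mxE enum_rankK.
pose A := \matrix_(i < size s) coef s`_i.
have mulA (w : 'rV_(size s)) : w *m A = coef (lincomb (fun i => w 0 i)).
  apply/rowP => j; rewrite !mxE /lincomb raddf_sum /=.
  by apply: eq_bigr => i _; rewrite !mxE mcoeffZ.
have A_free : row_free A.
  apply: inj_row_free => w; rewrite mulA => w0.
  apply/rowP => i; rewrite mxE.
  apply: (s_indep (fun i => w 0 i)).
  apply: coef_inj; rewrite ?lc_deg ?msize0 // w0.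
  by apply/rowP => j; rewrite !mxE mcoeff0.
have A_full : row_full A.
  by rewrite /row_full eqn_leq rank_leq_col (eqP A_free).
have /submxP[w coefE] := submx_full (coef v) A_full.
exists (fun i => w 0 i); apply: coef_inj => //.
by rewrite coefE mulA.
Qed.

Section Template.

Variable R : realType.
Implicit Types (B : polytope -> seq {mpoly R[2]}).

Definition det2 (a b : 'rV[R]_2) : R := a 0 0 * b 0 1 - a 0 1 * b 0 0.

(** Tagging each base function with its polytope turns the template tensor into a single list of
    pairs, in the order of the scalar basis. *)
Definition tagged_functions B : seq ({mpoly R[2]} * polytope) :=
  flatten [seq [seq (n, t) | n <- B t] | t <- polytopes].

Lemma template_tensor_flatten T B a b :
  (forall t, T t = [:: a t; b t]) ->
  template_tensor T B = flatten
    [seq [:: vprod nt.1 (a nt.2); vprod nt.1 (b nt.2)]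
       | nt <- tagged_functions B].
Proof.
move=> TE; rewrite /template_tensor /tagged_functions.
elim: polytopes => //= t ts ->; rewrite map_cat flatten_cat; congr (_ ++ _).
by rewrite /tensor TE -map_comp.
Qed.

Lemma map_fst_tagged_functions B :
  map fst (tagged_functions B) = flatten (map B polytopes).
Proof.
rewrite /tagged_functions; elim: polytopes => //= t ts IHts.
by rewrite map_cat IHts -map_comp map_id.
Qed.

Lemma template_tensor_basis (W : {mpoly R[2]} -> Prop) T B a b :
  (forall t, T t = [:: a t; b t]) -> (forall t, det2 (a t) (b t) != 0) ->
  is_basis W (flatten (map B polytopes)) ->
  is_basis (fun u : vpoly R => forall k, W (u k)) (template_tensor T B).
Proof.
move=> TE ab_free /is_basisP[/lin_indepP B_indep B_span].
set r := tagged_functions B; pose x0 : {mpoly R[2]} * polytope := (0, C123).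
(* Beyond [size r] the default [x0] still carries a genuine polytope, so [D_neq0] holds for every
   [i] without a range condition. *)
pose a' i := a (nth x0 r i).2; pose b' i := b (nth x0 r i).2.
have D_neq0 i : det2 (a' i) (b' i) != 0 by apply: ab_free.
(* Component [k] of a vectorial combination is a scalar one: base function [i] collects the [k]-th
   coordinates of its two template vectors. *)
have compE (c : nat -> R) k :
    (\sum_(i < size (template_tensor T B)) c i *: (template_tensor T B)`_i) k
    = \sum_(i < size (flatten (map B polytopes)))
        (c i.*2 * a' i 0 k + c i.*2.+1 * b' i 0 k)
          *: (flatten (map B polytopes))`_i.
  rewrite (template_tensor_flatten _ TE) (sum_flatten_pairs x0).
  rewrite -map_fst_tagged_functions size_map sum_ffunE.
  apply: eq_bigr => i _.
  by rewrite !ffunE (nth_map x0) // !scalerA -scalerDl.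
apply/is_basisP; split.
  apply/lin_indepP => c c0 j.
  (* Scalar independence leaves, for each base function, a homogeneous 2x2 system with unknowns
     [c i.*2] and [c i.*2.+1]. *)
  have sys k i : (i < size r)%N -> c i.*2 * a' i 0 k + c i.*2.+1 * b' i 0 k = 0.
    move=> lti.
    apply: (B_indep (fun i => c i.*2 * a' i 0 k + c i.*2.+1 * b' i 0 k)).
      by rewrite -compE c0 ffunE.
    by rewrite -map_fst_tagged_functions size_map.
  have c_pair i : (i < size r)%N -> c i.*2 = 0 /\ c i.*2.+1 = 0.
    move=> lti; have := sys 0 i lti; have := sys 1 i lti => s1 s0.
    split; apply: (mulIf (D_neq0 i)); rewrite mul0r.
      (* Eliminating one unknown from the two equations leaves the other multiplied by the
         determinant. *)
      have -> : c i.*2 * det2 (a' i) (b' i) =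
          (c i.*2 * a' i 0 0 + c i.*2.+1 * b' i 0 0) * b' i 0 1
          - (c i.*2 * a' i 0 1 + c i.*2.+1 * b' i 0 1) * b' i 0 0.
        by rewrite /det2; ring.
      by rewrite s0 s1 !mul0r subrr.
    have -> : c i.*2.+1 * det2 (a' i) (b' i) =
        a' i 0 0 * (c i.*2 * a' i 0 1 + c i.*2.+1 * b' i 0 1)
        - a' i 0 1 * (c i.*2 * a' i 0 0 + c i.*2.+1 * b' i 0 0).
      by rewrite /det2; ring.
    by rewrite s0 s1 !mulr0 subrr.
  rewrite (template_tensor_flatten _ TE) size_flatten_pairs => ltj.
  (* Position [j] belongs to base function [j./2]; its parity selects the template vector. *)
  have /c_pair[ce co] : (j./2 < size r)%N by rewrite ltn_half_double.
  by rewrite -[j]odd_double_half; case: (odd j).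
move=> v; split=> [Wv | [c ->] k]; last first.
  rewrite B_span compE.
  by exists (fun i => c i.*2 * a' i 0 k + c i.*2.+1 * b' i 0 k).
have [/B_span[d0 v0E] /B_span[d1 v1E]] := (Wv 0, Wv 1).
(* Cramer's rule *)
pose c j := let i := j./2 in
  (if odd j then a' i 0 0 * d1 i - a' i 0 1 * d0 i
   else d0 i * b' i 0 1 - d1 i * b' i 0 0) / det2 (a' i) (b' i).
have cE i : c i.*2 = (d0 i * b' i 0 1 - d1 i * b' i 0 0) / det2 (a' i) (b' i).
  by rewrite /c odd_double doubleK.
have cO i : c i.*2.+1 =
    (a' i 0 0 * d1 i - a' i 0 1 * d0 i) / det2 (a' i) (b' i).
  by rewrite /c /= odd_double uphalf_double.
exists c; apply/ffunP => k; rewrite compE.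
have [-> | ->] : k = 0 \/ k = 1.
  by case: k => -[|[|]] // ?; [left | right]; apply: val_inj.
  rewrite v0E; apply: eq_bigr => i _; congr (_ *: _); rewrite cE cO.
  by have := D_neq0 i; rewrite /det2 => ?; field.
rewrite v1E; apply: eq_bigr => i _; congr (_ *: _); rewrite cE cO.
by have := D_neq0 i; rewrite /det2 => ?; field.
Qed.

(** In two variables there are [k+1] monomials of degree [k], so at most [(p+2)(p+1)/2] of degree at
    most [p], which is the total number of base functions. *)
Lemma h1_conforming_is_basis p B : (1 <= p)%N -> h1_conforming_basis p B ->
  is_basis (fun n : {mpoly R[2]} => n \in Pp p) (flatten (map B polytopes)).
Proof.
move=> p_gt0 [B_deg B_indep B_size _ _ _ _].
apply: lin_indep_mpoly_basis => // [q|].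
  elim: polytopes => //= t ts IHts.
  by rewrite mem_cat => /orP[/B_deg | /IHts].
apply: leq_trans (leq_card_bmultinom _ _) _.
rewrite size_flatten /shape -map_comp (eq_map B_size).
rewrite sum_num_base_functions //.
have -> : (\sum_(k < p.+1) 'C(k + 1, k) = \sum_(k < p.+1) k.+1)%N.
  by apply: eq_bigr => k _; rewrite addn1 binSn.
rewrite leq_divRL //; elim: (p) => [|m IHm].
  by rewrite big_ord_recr big_ord0.
by rewrite big_ord_recr /=; move: (\sum_(k < _) _)%N IHm => S; nia.
Qed.

(** The determinant is [-1] at the three vertices and on [E23], and [1] on [E12], [E13] and
    [C123]. *)
Lemma bdm_template_det2 t :
  det2 (bdm_template R t)`_0 (bdm_template R t)`_1 != 0.
Proof.
by case: t => [[]|[]|] /=; rewrite /det2 !mxE /= ?eqxx /=; apply/eqP; lra.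
Qed.

End Template.

Theorem theorem3p3 (R : realType) (p : nat)
    (U : polytope -> seq {mpoly R[2]}) :
  (1 <= p)%N -> h1_conforming_basis p U ->
  unisolvent_bdm p (template_tensor (@bdm_template R) U).
Proof.
move=> p_gt0 U_basis.
apply: (template_tensor_basis (W := fun n => n \in Pp p)
  (a := fun t => (bdm_template R t)`_0) (b := fun t => (bdm_template R t)`_1)).
- by case=> [[]|[]|].
- exact: bdm_template_det2.
- exact: h1_conforming_is_basis.
Qed.
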